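(* Let $\mathcal{A}$ be a (not necessarily associative) algebra over a field $\mathbb{F}$ with $\dim_{\mathbb{F}}(\mathcal{A})>1$. If $\mathrm{ann}(\mathcal{A})$ is not contained in $\mathcal{A}^2$, then $\mathcal{A}$ is decomposable.
   Context: $\mathrm{ann}(\mathcal{A})=\{x\in\mathcal{A}: x\mathcal{A}=\mathcal{A}x=0\}$, and $\mathcal{A}^2$ is the linear span of all products $xy$ with $x,y\in\mathcal{A}$. An algebra $\mathcal{A}$ is decomposable if there are nonzero ideals $\mathcal{I}$ and $\mathcal{J}$ with $\mathcal{A}=\mathcal{I}\oplus\mathcal{J}$; otherwise it is indecomposable. Algebras need not be associative, commutative or unital. *)

(* Defs.v *)
From mathcomp Require Import all_boot all_order all_algebra.
From mathcomp Require Import sesquilinear.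
From mathcomp Require Import boolp classical_sets functions cardinality.

Set Implicit Arguments.
Unset Strict Implicit.
Unset Printing Implicit Defensive.

Import GRing.Theory.
Local Open Scope classical_set_scope.
Local Open Scope ring_scope.
Local Open Scope card_scope.

(* Vector spaces are of arbitrary, possibly infinite, dimension: a left module
   over a field, with Hamel bases as sets of vectors. *)
Section VectorSpace.
Variables (F : fieldType) (V : lmodType F).
Implicit Types (S B : set V).

Definition linear_span S : set V :=
  [set v | exists (s : seq V) (c : V -> F),
    [set` s] `<=` S /\ v = \sum_(u <- s) c u *: u].

Definition linearly_independent B : Prop :=
  forall (s : seq V) (c : V -> F), uniq s -> [set` s] `<=` B ->
    \sum_(u <- s) c u *: u = 0 -> forall u, u \in s -> c u = 0.

Definition is_basis B : Prop :=
  linearly_independent B /\ linear_span B = [set: V].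

(* The dimension is the common cardinality of all bases; `I_n is the set of the
   natural numbers smaller than n. *)
Definition dim_gt (n : nat) : Prop := exists B, is_basis B /\ ~ (B #<= `I_n).

End VectorSpace.

Arguments dim_gt {F} V n.

(* An algebra is a vector space A with a bilinear product mul, not assumed to be
   associative, commutative or unital. *)
Section Algebra.
Variables (F : fieldType) (A : lmodType F) (mul : {bilinear A -> A -> A}).
Implicit Types (I J : set A).

Definition ann : set A :=
  [set x | forall y, mul x y = 0 /\ mul y x = 0].

Definition square : set A :=
  linear_span [set z | exists x y, z = mul x y].

Definition is_ideal I : Prop :=
  GRing.submod_closed (mem I) /\
  (forall x a, I x -> I (mul a x) /\ I (mul x a)).

Definition direct_sum_decomposition I J : Prop :=
  [set x + y | x in I & y in J] = [set: A] /\ I `&` J = [set 0].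

Definition decomposable : Prop :=
  exists I J, [/\ is_ideal I, is_ideal J, I <> [set 0], J <> [set 0]
    & direct_sum_decomposition I J].

End Algebra.

(* Main.v *)
(* Choose [x] in [ann A] outside [A^2].  By Zorn's lemma there is a subspace [J]
   containing [A^2] and maximal among those avoiding [x]; maximality forces
   [A = F x + J].  The line [F x] is an ideal because [x] annihilates [A], and
   [J] is an ideal because it contains [A^2]; [J] is nonzero as [dim A > 1]. *)
Require Import Defs.
From mathcomp Require Import all_boot all_order all_algebra.
From mathcomp Require Import sesquilinear.
From mathcomp Require Import boolp classical_sets functions cardinality.

Local Open Scope classical_set_scope.
Local Open Scope ring_scope.

Import GRing.Theory.

Section VectorSpace.
Context {F : fieldType} {V : lmodType F}.
Implicit Types (S J B : set V) (x : V).

Definition linear_set J := forall (a : F) u v, J u -> J v -> J (a *: u + v).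

Lemma linear_setZ J a u : linear_set J -> J u -> J (a *: u).
Proof.
(* Membership of [0] is not part of [linear_set], so [a *: u] is reached as [(a - 1) *: u + u]. *)
move=> Jlin Ju; have := Jlin (a - 1) u u Ju Ju.
by rewrite scalerBl scale1r subrK.
Qed.

(** Lists in [linear_span] may repeat vectors, and each repetition adds the coefficient once more.
    Collecting multiplicities brings two combinations onto a common duplicate-free list, where they
    can be added termwise. *)
Lemma sum_uniq_count (s t : seq V) (c : V -> F) :
  uniq t -> {subset s <= t} ->
  \sum_(u <- s) c u *: u = \sum_(u <- t) (c u *+ count_mem u s) *: u.
Proof.
move=> t_uniq; elim: s => [|v s IHs] st.
  by rewrite big_nil big1 // => u _; rewrite /= mulr0n scale0r.
rewrite big_cons IHs; last by move=> u us; apply: st; rewrite inE us orbT.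
under [RHS]eq_bigr do rewrite /= mulrnDr scalerDl.
rewrite big_split /=; congr (_ + _).
rewrite (bigD1_seq v) ?st ?mem_head //= eqxx mulr1n big1 ?addr0 // => u uv.
by rewrite eq_sym (negPf uv) mulr0n scale0r.
Qed.

Lemma linear_span_linear S : linear_set (linear_span S).
Proof.
move=> a _ _ [s [c [sS ->]]] [t [d [tS ->]]].
exists (undup (s ++ t)).
exists (fun u => a * (c u *+ count_mem u s) + d u *+ count_mem u t); split.
  by move=> u /=; rewrite mem_undup mem_cat => /orP[/sS|/tS].
under [RHS]eq_bigr do rewrite scalerDl -scalerA.
rewrite big_split /= -scaler_sumr.
by congr (_ *: _ + _); apply: sum_uniq_count; rewrite ?undup_uniq // => u us;
  rewrite mem_undup mem_cat us ?orbT.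
Qed.

Lemma linear_span0 S : linear_span S 0.
Proof. by exists [::], (fun=> 0); rewrite big_nil; split. Qed.

Lemma sub_linear_span S : S `<=` linear_span S.
Proof.
move=> u Su; exists [:: u], (fun=> 1); split; last by rewrite big_seq1 scale1r.
by move=> v /=; rewrite inE => /eqP ->.
Qed.

Lemma exists_complement_line S x : ~ linear_span S x ->
  exists J, [/\ linear_set J, linear_span S `<=` J, ~ J x &
    forall v, exists a, J (v - a *: x)].
Proof.
move=> Sx.
(* The last condition lets the empty set qualify, being the union of the empty
   chain. *)
pose P J := [/\ linear_set J, ~ J x & J !=set0 -> linear_span S `<=` J].
have [C CP Ctot|J [[Jlin Jx JS] Jmax]] := @Zorn_bigcup V P.
  split=> [a u v [X CX Xu] [Y CY Yv]|[X CX Xx]|[u [X CX Xu]] v Sv].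
  - have [XY|YX] := Ctot _ _ CX CY.
    + by exists Y => //; have [Ylin _ _] := CP _ CY; apply: Ylin => //; apply: XY.
    + by exists X => //; have [Xlin _ _] := CP _ CX; apply: Xlin => //; apply: YX.
  - by have [_ /(_ Xx)] := CP _ CX.
  - by exists X => //; have [_ _] := CP _ CX; apply => //; exists u.
(* Were [J] empty, [linear_span S] would be a strictly larger member of [P]: it contains [0] and
   avoids [x] by hypothesis. *)
have J0 : J !=set0.
  apply: contrapT => /set0P/negP; rewrite negbK => /eqP J0.
  apply: (Jmax (linear_span S)); last first.
    by split=> [|//|_]; [apply: linear_span_linear | apply: subset_refl].
  by rewrite J0 properEneq; split=> //; apply/eqP => /esym S0;
    have := linear_span0 S; rewrite S0.
exists J; split=> // [|v]; first exact: JS.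
have [Jv|Jv] := pselect (J v); first by exists 0; rewrite scale0r subr0.
(* [K] is the subspace [J + F v], strictly larger than [J] since it contains [v]; by maximality it
   cannot avoid [x]. *)
pose K := [set w | exists a, J (w - a *: v)].
have Kx : K x.
  apply: contrapT => Kx; apply: (Jmax K).
    split; first by move=> w Jw; exists 0; rewrite scale0r subr0.
    by move=> /(_ v) KJ; apply: Jv; apply: KJ; exists 1;
      rewrite scale1r subrr; apply: JS => //; apply: linear_span0.
  split=> // [a u w [b Jb] [c Jc]|_ w Sw].
    exists (a * b + c); have := Jlin a _ _ Jb Jc.
    by rewrite scalerBr scalerDl scalerA opprD addrACA.
  by exists 0; rewrite scale0r subr0; apply: JS.
have [a Ja] := Kx; have a0 : a != 0.
  by apply: contra_notN Jx => /eqP a0; rewrite a0 scale0r subr0 in Ja.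
(* Multiplying [x - a *: v] by [- a^-1] turns it into [v - a^-1 *: x]. *)
exists a^-1; have := linear_setZ _ (- a^-1) _ Jlin Ja.
by rewrite scalerBr scalerA mulNr mulVf // !scaleNr scale1r opprK addrC.
Qed.

(** Distinct basis vectors [a *: x] and [b *: x] would satisfy [b *: (a *: x) - a *: (b *: x) = 0];
    independence would force [a = b = 0], making both vectors zero. So a basis inside a line has at
    most one element. *)
Lemma dim_gt1_not_line x : dim_gt V 1 -> ~ (forall v, exists a, v = a *: x).
Proof.
move=> [B [[Bfree _] Bcard]] line; apply: Bcard.
have B_eq u v : B u -> B v -> u = v.
  move=> Bu Bv; apply/eqP/negPn/negP => uv.
  have [a ua] := line u; have [b vb] := line v.
  have sub : [set` [:: u; v]] `<=` B.
    by move=> w /=; rewrite !inE => /orP[] /eqP ->.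
  have uniq_uv : uniq [:: u; v] by rewrite /= inE uv.
  have /(_ _) cz := Bfree _ (fun w => if w == u then b else - a) uniq_uv sub.
  have v_u : (v == u) = false by rewrite eq_sym; apply/negbTE.
  have {}cz : forall w, w \in [:: u; v] -> (if w == u then b else - a) = 0.
    apply: cz; rewrite !big_cons big_nil addr0 eqxx v_u {1}ua vb !scalerA.
    by rewrite -scalerDl mulNr mulrC subrr scale0r.
  have := cz u; rewrite !inE !eqxx => /(_ isT) b0.
  have := cz v; rewrite !inE !eqxx orbT v_u => /(_ isT) /eqP.
  rewrite oppr_eq0 => /eqP a0.
  by move: uv; rewrite ua vb a0 b0 eqxx.
have [->|/set0P[u Bu]] := eqVneq B set0; first exact: card_ge0.
have -> : B = [set u].
  by apply/seteqP; split=> [w Bw|w ->] //=; apply: B_eq.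
by by have := @card_set1 V u; rewrite card_eq_le => /andP[].
Qed.

End VectorSpace.

Theorem corollary2p5 (F : fieldType) (A : lmodType F)
    (mul : {bilinear A -> A -> A}) (hdim : dim_gt A 1%N)
    (hann : ~ (ann mul `<=` square mul)) :
  decomposable mul.
Proof.
have [x [xann xsq]] : exists x, ann mul x /\ ~ square mul x.
  by apply: contrapT => nx; apply: hann => x xa; apply: contrapT => xs;
    apply: nx; exists x.
have [J [Jlin Jsq Jx JxA]] := exists_complement_line _ _ xsq.
have J0 : J 0 by apply/Jsq/linear_span0.
have Jmul u v : J (mul u v) by apply/Jsq/sub_linear_span; exists u, v.
exists [set a *: x | a in [set: F]], J; split.
- split.
    split; first by rewrite inE; exists 0; rewrite ?scale0r.
    move=> a u v; rewrite !inE => -[b _ <-] [c _ <-].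
    by exists (a * b + c); rewrite // scalerDl scalerA.
  (* Both products of [a *: x] with [y] vanish, so they lie on the line with scalar [0]. *)
  move=> _ y [a _ <-]; have [xy yx] := xann y.
  by split; exists 0; rewrite // scale0r ?linearZl_LR ?linearZr_LR /= ?xy ?yx scaler0.
- split; last by [].
  by split=> [|a u v]; rewrite !inE //; apply: Jlin.
- move=> I0; have : [set a *: x | a in [set: F]] x by exists 1; rewrite ?scale1r.
  by rewrite I0 /= => x0; apply: Jx; rewrite x0.
- move=> J_0; apply: (dim_gt1_not_line x hdim) => v.
  have [a] := JxA v; rewrite J_0 /= => /eqP.
  by rewrite subr_eq0 => /eqP ->; exists a.
- split.
    apply/seteqP; split=> // v _; have [a Ja] := JxA v.
    by exists (a *: x); [exists a | exists (v - a *: x); rewrite // addrC subrK].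
  apply/seteqP; split=> [_ [[a _ <-] Jax]|_ ->] /=; last first.
    by split=> //; exists 0; rewrite ?scale0r.
  have [->|a0] := eqVneq a 0; first by rewrite scale0r.
  (* A nonzero multiple of [x] in [J] could be rescaled to put [x] itself in [J]. *)
  case: Jx; have := linear_setZ _ a^-1 _ Jlin Jax.
  by rewrite scalerA mulVf // scale1r.
Qed.
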